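(* Let $a_1,\dots,a_k>0$ and $T>0$ be real numbers. Agents with intervals $(a_1,\dots,a_k)$ can achieve idle time $T$ in the Point Patrolling Problem if and only if the tuple of positive integers $(\lceil a_1/T\rceil,\dots,\lceil a_k/T\rceil)$ is good.
   Context: Point Patrolling Problem: for reals $a_1,\dots,a_k>0$, a schedule is a $k$-tuple of sets $S_1,\dots,S_k\subseteq\mathbb{R}$ (the times at which agent $i$ visits the point) such that any two distinct $t_1,t_2\in S_i$ satisfy $|t_1-t_2|\ge a_i$. The schedule achieves idle time $T$ if for every $t\in\mathbb{R}$ there are $i$ and $t'\in[t,t+T)$ with $t'\in S_i$. A tuple $(b_1,\dots,b_k)$ of positive integers is good if there are sets $S_1,\dots,S_k\subseteq\mathbb{R}$ such that any two distinct elements of $S_i$ differ by at least $b_i$ and every integer belongs to $S_1\cup\dots\cup S_k$; otherwise it is bad. *)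

(* Defs.v *)
From mathcomp Require Import all_boot all_order all_algebra.
From mathcomp Require Import classical_sets reals.

Set Implicit Arguments.
Unset Strict Implicit.
Unset Printing Implicit Defensive.

Import Order.TTheory GRing.Theory Num.Theory.
Local Open Scope ring_scope.
Local Open Scope classical_set_scope.

Definition separated (R : realType) (d : R) (A : set R) : Prop :=
  forall t1 t2 : R, A t1 -> A t2 -> t1 <> t2 -> d <= `|t1 - t2|.

Definition schedule (R : realType) (k : nat) (a : 'I_k -> R)
    (S : 'I_k -> set R) : Prop :=
  forall i : 'I_k, separated (a i) (S i).

Definition achieves_idle_time (R : realType) (k : nat) (S : 'I_k -> set R)
    (T : R) : Prop :=
  forall t : R, exists (i : 'I_k) (t' : R), t <= t' < t + T /\ S i t'.

Definition can_achieve_idle_time (R : realType) (k : nat) (a : 'I_k -> R)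
    (T : R) : Prop :=
  exists S : 'I_k -> set R, schedule a S /\ achieves_idle_time S T.

(* Goodness is only meaningful for tuples of positive integers, so positivity
   is part of the predicate. The real field R, in which the sets S i live,
   does not occur in b and is passed explicitly. *)
Definition good (R : realType) (k : nat) (b : 'I_k -> int) : Prop :=
  (forall i : 'I_k, 0 < b i) /\
  exists S : 'I_k -> set R,
    (forall i : 'I_k, separated ((b i)%:~R : R) (S i)) /\
    (forall n : int, exists i : 'I_k, S i (n%:~R : R)).

Arguments good R {k} b.

(* Main.v *)
Require Import Defs.
From mathcomp Require Import all_boot all_order all_algebra.
From mathcomp Require Import classical_sets reals.
From mathcomp Require Import boolp lra.

Import Order.TTheory GRing.Theory Num.Theory.
Local Open Scope ring_scope.

(** If the tuple is good, rescaling the integer visits by [T] gives a schedule.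
    Conversely, rounding each visit time to a multiple of [T] would only give
    floors. Instead, enumerate visits as a strictly increasing two-sided sequence
    [(u n)] with gaps at most [T] and let the agent that visits at [u n] serve the
    integer [n]: two visits of agent [i] satisfy
    [a i <= `|u n - u m| <= T * `|n - m|], and [`|n - m|] is an integer. *)

(** Two points of [A] in [(x, x + d)] would be less than [d] apart, so there is at most one; [e] is
    its distance from [x], or [d] if there is none. *)
Lemma separated_right_gap {R : realType} {d : R} {A : set R} (x : R) :
  0 < d -> separated d A ->
  exists2 e : R, 0 < e & forall y, A y -> x < y -> x + e <= y.
Proof.
move=> d0 sepA.
have [[s [As xs sd]]|nos] := pselect (exists s, [/\ A s, x < s & s < x + d]).
  exists (s - x) => [|y Ay xy]; first by rewrite subr_gt0.
  rewrite addrC subrK leNgt; apply/negP => ys.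
  have /(sepA _ _ As Ay) : s <> y by move=> sy; rewrite sy ltxx in ys.
  by rewrite gtr0_norm ?subr_gt0 //; lra.
exists d => // y Ay xy; rewrite leNgt; apply/negP => yd.
by apply: nos; exists y.
Qed.

Lemma schedule_right_gap {R : realType} {k : nat} {a : 'I_k -> R}
    {S : 'I_k -> set R} (x : R) :
  (forall i, 0 < a i) -> schedule a S ->
  exists2 e : R, 0 < e & forall i y, S i y -> x < y -> x + e <= y.
Proof.
move=> a0 schS.
have /choice[e eP] : forall i, exists e : R,
    0 < e /\ forall y, S i y -> x < y -> x + e <= y.
  by move=> i; have [e] := separated_right_gap x (a0 i) (schS i); exists e.
(* The seed [1] keeps the minimum positive even when [k = 0]. *)
exists (\big[Num.min/1]_i e i).
  by elim/big_ind: _ => // [p q p0 q0|i _]; [rewrite lt_min p0|case: (eP i)].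
move=> i y Siy xy; apply: le_trans ((eP i).2 y Siy xy).
by rewrite lerD2l bigmin_le_cond.
Qed.

(* The hypothesis on windows [[t, t + T)] does not directly give a visit in
   [(x, x + T]]; it does because visits cannot accumulate at [x + T] from the
   right. *)
Lemma idle_time_next {R : realType} {k : nat} {a : 'I_k -> R}
    {S : 'I_k -> set R} {T : R} (x : R) :
  (forall i, 0 < a i) -> schedule a S -> achieves_idle_time S T ->
  exists y, (exists i, S i y) /\ x < y <= x + T.
Proof.
move=> a0 schS idleS.
have [e e0 eP] := schedule_right_gap (x + T) a0 schS.
(* The shifted window [[x + e, x + e + T)] excludes [x], and by the choice of [e] it contains no
   visit after [x + T]. *)
have [i [y [/andP[xy yT] Siy]]] := idleS (x + e).
exists y; split; first by exists i.
apply/andP; split; first lra.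
by rewrite leNgt; apply/negP => /(eP i y Siy); lra.
Qed.

Lemma two_sided_sequence {X : Type} {P : X -> X -> Prop} (x0 : X) :
  (forall x, exists y, P x y) -> (forall x, exists y, P y x) ->
  exists u : int -> X, forall n, P (u n) (u (n + 1)).
Proof.
move=> /choice[f fP] /choice[g gP].
(* [Negz m] stands for [-(m + 1)], hence [m.+1] backward steps from [x0]. *)
exists (fun n => match n with
  | Posz m => iter m f x0 | Negz m => iter m.+1 g x0 end).
case=> [m|[|m]]; first by rewrite -PoszD addn1 /=; exact: fP.
  exact: gP.
have -> : Negz m.+1 + 1 = Negz m by rewrite !NegzE -(addn1 m.+1) PoszD opprD subrK.
exact: gP.
Qed.

Lemma bounded_gap_sequence {R : numDomainType} {u : int -> R} {T : R} :
  (forall n, u n < u (n + 1) <= u n + T) ->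
  forall m n, m < n -> u m < u n <= u m + T * (n - m)%:~R.
Proof.
move=> uP m n mn.
have [j ->] : exists j : nat, n = m + j.+1%:Z.
  have : 0 < n - m by rewrite subr_gt0.
  case E : (n - m) => [[|j]|j] // _; exists j.
  by rewrite -E addrC subrK.
rewrite [m + _]addrC addrK [_ + m]addrC.
elim: j => [|j /andP[IH1 IH2]]; first by rewrite mulr1 uP.
have /andP[s1 s2] := uP (m + j.+1%:Z).
have -> : m + j.+2%:Z = m + j.+1%:Z + 1 by rewrite -addrA -PoszD addn1.
rewrite (lt_trans IH1 s1) (le_trans s2) //.
by rewrite -[j.+2]addn1 PoszD intrD mulrDr mulr1 addrA lerD2r.
Qed.

Lemma good_of_idle_time {R : realType} {k : nat} {a : 'I_k -> R} {T : R} :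
  (forall i, 0 < a i) -> 0 < T -> can_achieve_idle_time a T ->
  good R (fun i => Num.ceil (a i / T)).
Proof.
move=> a0 T0 [S [schS idleS]].
split=> [i|]; first by rewrite ceil_gt0 divr_gt0.
pose V := {x : R | exists i, S i x}.
pose P (x y : V) := sval x < sval y <= sval x + T.
have next (x : V) : exists y, P x y.
  have [y [Vy xy]] := idle_time_next (sval x) a0 schS idleS.
  by exists (exist _ y Vy).
have prev (x : V) : exists y, P y x.
  (* The window [[x - T, x)] already excludes [x], so it yields a predecessor directly. *)
  have [i [y [/andP[xy yx] Siy]]] := idleS (sval x - T).
  exists (exist _ y (ex_intro _ i Siy)); rewrite /P /=; apply/andP.
  by split; lra.
have [i0 [x0 [_ Vx0]]] := idleS 0.
have [u uP] :=
  two_sided_sequence (exist _ x0 (ex_intro _ i0 Vx0) : V) next prev.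
pose v n := sval (u n).
have vP : forall m n, m < n -> v m < v n <= v m + T * (n - m)%:~R.
  exact: bounded_gap_sequence.
exists (fun i => [set x | exists2 n : int, x = n%:~R & S i (v n)]%classic).
split=> [i _ _ [m -> Sm] [n -> Sn] mn|n]; last first.
  by have [i Si] := svalP (u n); exists i, n.
wlog lt_mn : m n Sm Sn mn / m < n => [hwlog|].
  have [mltn|nltm|E] := ltgtP m n; first exact: hwlog.
    by rewrite distrC; apply: hwlog => // /esym.
  by rewrite E in mn.
have /andP[v_lt v_le] := vP _ _ lt_mn.
rewrite distrC -intrB gtr0_norm ?ltr0z ?subr_gt0 //.
(* As [n - m] is an integer, it bounds the ceiling as soon as it bounds [a i / T]. *)
rewrite ler_int ceil_le_int ler_pdivrMr // mulrC.
have /(schS i _ _ Sn Sm) : v n <> v m by move=> E; rewrite E ltxx in v_lt.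
by rewrite gtr0_norm ?subr_gt0 //; lra.
Qed.

Lemma idle_time_of_good {R : realType} {k : nat} {a : 'I_k -> R} {T : R} :
  0 < T -> good R (fun i => Num.ceil (a i / T)) -> can_achieve_idle_time a T.
Proof.
move=> T0 [_ [S [sepS covS]]].
exists (fun i => [set x | exists2 n : int, x = n%:~R * T & S i n%:~R]%classic).
split=> [i _ _ [m -> Sm] [n -> Sn] mn|t].
  rewrite -mulrBl normrM (gtr0_norm T0) -ler_pdivrMr //.
  apply: le_trans (ceil_ge _) (sepS i _ _ Sm Sn _) => E.
  by rewrite E in mn.
(* The visit is at the least multiple of [T] that is at least [t]; it lies before [t + T] because a
   ceiling exceeds its argument by less than [1]. *)
have [i Si] := covS (Num.ceil (t / T)).
exists i, ((Num.ceil (t / T))%:~R * T); split; last by exists (Num.ceil (t / T)).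
rewrite -ler_pdivrMr // ceil_ge /=.
rewrite -ltr_pdivlMr // mulrDl divff ?gt_eqF // -ltrBlDr.
by rewrite -[1]/(1%:~R) -intrB ceilB1_lt.
Qed.

Theorem theorem4 (R : realType) (k : nat) (a : 'I_k -> R) (T : R)
    (a_gt0 : forall i : 'I_k, 0 < a i) (T_gt0 : 0 < T) :
  can_achieve_idle_time a T <-> good R (fun i : 'I_k => Num.ceil (a i / T)).
Proof.
by split; [exact: good_of_idle_time|exact: idle_time_of_good].
Qed.
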